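(* Let $\Psi:\mathbb{R}^n\to\mathbb{R}\cup\{\infty\}$ be a proper, lower semi-continuous and convex function with proximal map $\sigma$, let $B_\Psi$ be the associated Bregman loss function, and for $z\in\mathbb{R}^n$ let $E_z(x):=\frac12\|x-z\|^2+\Psi(x)$. Then the following hold. 1. $B_\Psi(x,z)=E_z(x)-E_z(\sigma(z))$ for all $x,z\in\mathbb{R}^n$. 2. $B_\Psi(x,z)=D^{z}_{\frac12\|\cdot\|^2+\Psi}(x,\sigma(z))$ for all $x,z\in\mathbb{R}^n$. 3. $B_\Psi(x,z)=\frac12\|x-\sigma(z)\|^2+D_\Psi^{z-\sigma(z)}(x,\sigma(z))\ \ge\ \frac12\|x-\sigma(z)\|^2$ for all $x,z\in\mathbb{R}^n$. 4. $B_\Psi(x,z)=\frac12\|x-\sigma(z)\|^2+\Psi(x)-\Psi(\sigma(z))-\langle z-\sigma(z),x-\sigma(z)\rangle$ for all $x,z\in\mathbb{R}^n$. 5. For every fixed $x\in\mathrm{dom}(\Psi)$, the function $z\mapsto B_\Psi(x,z)$ is continuously differentiable on $\mathbb{R}^n$. 6. $\nabla_z B_\Psi(x,z)=\sigma(z)-x$ for all $x\in\mathrm{dom}(\Psi)$ and $z\in\mathbb{R}^n$. 7. For every $x$ with $\partial\Psi(x)\neq\emptyset$, the function $z\mapsto B_\Psi(x,z)$ attains its global minimum over $\mathbb{R}^n$, and it does so exactly at those $z$ for which $x=\sigma(z)$. 8. $B_\Psi$ is bi-convex: $x\mapsto B_\Psi(x,z)$ is convex for every fixed $z\in\mathbb{R}^n$,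 and $z\mapsto B_\Psi(x,z)$ is convex for every fixed $x\in\mathbb{R}^n$. For $x\in\mathrm{dom}(\Psi)$ define the operator $G_x:\mathbb{R}^n\to\mathbb{R}^n$, $G_x(z):=\nabla_z B_\Psi(x,z)=\sigma(z)-x$. Then: 9. $G_x$ is monotone, i.e. $\langle G_x(z_1)-G_x(z_2),z_1-z_2\rangle\ge 0$ for all $z_1,z_2\in\mathbb{R}^n$. 10. $G_x$ is Lipschitz-continuous with Lipschitz constant one, i.e. $\|G_x(z_1)-G_x(z_2)\|\le\|z_1-z_2\|$ for all $z_1,z_2\in\mathbb{R}^n$. 11. $G_x$ is firmly non-expansive, i.e. $\langle G_x(z_1)-G_x(z_2),z_1-z_2\rangle\ge\|G_x(z_1)-G_x(z_2)\|^2$ for all $z_1,z_2\in\mathbb{R}^n$.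
   Context: $\|\cdot\|$ and $\langle\cdot,\cdot\rangle$ are the Euclidean norm and inner product on $\mathbb{R}^n$; $\partial$ denotes the convex subdifferential; $\mathrm{dom}(\Psi)=\{x:\Psi(x)<\infty\}$. Proximal map: $\sigma(z)=\mathrm{prox}_\Psi(z):=\arg\min_{u\in\mathbb{R}^n}\{\frac12\|u-z\|^2+\Psi(u)\}$. Equivalently, $z-\sigma(z)\in\partial\Psi(\sigma(z))$, i.e. $z\in\partial(\frac12\|\cdot\|^2+\Psi)(\sigma(z))$. Fenchel conjugate: $F^*(y):=\sup_x\{\langle x,y\rangle-F(x)\}$. Bregman loss function: for $x,z\in\mathbb{R}^n$, $$B_\Psi(x,z):=\tfrac12\|x\|^2+\Psi(x)+\left(\tfrac12\|\cdot\|^2+\Psi\right)^*(z)-\langle x,z\rangle\in\mathbb{R}\cup\{\infty\}.$$ Generalised Bregman distance: for a proper, lower semi-continuous, convex function $\Phi$, a point $v$ and a subgradient $q\in\partial\Phi(v)$, $D_\Phi^{q}(u,v):=\Phi(u)-\Phi(v)-\langle q,u-v\rangle$. Both sides of identities may equal $+\infty$ when $x\notin\mathrm{dom}(\Psi)$. *)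

(* Defs.v *)
From HB Require Import structures.
From mathcomp Require Import all_boot all_order all_algebra.
From mathcomp Require Import boolp classical_sets reals ereal topology normedtype.
From mathcomp Require Import derive.

Set Implicit Arguments.
Unset Strict Implicit.
Unset Printing Implicit Defensive.

Import Order.TTheory GRing.Theory Num.Theory.
Import numFieldNormedType.Exports.

Local Open Scope classical_set_scope.
Local Open Scope ring_scope.
Local Open Scope ereal_scope.

(* R^n is 'rV[R]_n. The library norm `|x| on 'rV[R]_n is the sup norm: it is
   used only for the topology and for differentiability, which do not depend on
   the choice of a norm. The Euclidean structure is given here. *)
Definition inner (R : realType) (n : nat) (x y : 'rV[R]_n) : R :=
  (\sum_(i < n) x 0 i * y 0 i)%R.

Definition enorm (R : realType) (n : nat) (x : 'rV[R]_n) : R :=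
  Num.sqrt (inner x x).

(* 1/2 ||x||^2 *)
Definition halfsq (R : realType) (n : nat) (x : 'rV[R]_n) : R :=
  (2^-1 * enorm x ^+ 2)%R.

Definition eproper (R : realType) (n : nat) (F : 'rV[R]_n -> \bar R) : Prop :=
  (forall x, -oo < F x) /\ (exists x, F x < +oo).

Definition edom (R : realType) (n : nat) (F : 'rV[R]_n -> \bar R) :
    set 'rV[R]_n :=
  [set x | F x < +oo].

(* Meant for functions with values in ]-oo, +oo]; at t = 0 and t = 1 the
   convention 0 * +oo = 0 makes the inequality trivial. *)
Definition econvex (R : realType) (n : nat) (F : 'rV[R]_n -> \bar R) : Prop :=
  forall (x y : 'rV[R]_n) (t : R), (0 <= t <= 1)%R ->
    F (t *: x + (1 - t) *: y)%R <= t%:E * F x + (1 - t)%:E * F y.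

Definition subdiff (R : realType) (n : nat) (F : 'rV[R]_n -> \bar R)
    (v : 'rV[R]_n) : set 'rV[R]_n :=
  [set q | F v < +oo /\ forall u, F v + (inner q (u - v)%R)%:E <= F u].

Definition argmin (R : realType) (n : nat) (F : 'rV[R]_n -> \bar R) :
    set 'rV[R]_n :=
  [set u | forall v, F u <= F v].

Definition fconj (R : realType) (n : nat) (F : 'rV[R]_n -> \bar R)
    (y : 'rV[R]_n) : \bar R :=
  ereal_sup [set (inner x y)%:E - F x | x in [set: 'rV[R]_n]].

(* E_z *)
Definition prox_energy (R : realType) (n : nat) (Psi : 'rV[R]_n -> \bar R)
    (z x : 'rV[R]_n) : \bar R :=
  (halfsq (x - z))%:E + Psi x.

(* A minimiser of E_z, picked by choice (and 0 if there were none). *)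
Definition prox (R : realType) (n : nat) (Psi : 'rV[R]_n -> \bar R)
    (z : 'rV[R]_n) : 'rV[R]_n :=
  xget 0%R (argmin (prox_energy Psi z)).

(* 1/2 ||.||^2 + Psi *)
Definition halfsq_plus (R : realType) (n : nat) (Psi : 'rV[R]_n -> \bar R)
    (x : 'rV[R]_n) : \bar R :=
  (halfsq x)%:E + Psi x.

Definition bregman_loss (R : realType) (n : nat) (Psi : 'rV[R]_n -> \bar R)
    (x z : 'rV[R]_n) : \bar R :=
  (halfsq x)%:E + Psi x + fconj (halfsq_plus Psi) z - (inner x z)%:E.

(* D_Phi^q(u, v); meaningful only when q \in subdiff Phi v, which has to be
   asserted along with any use. *)
Definition bregman_dist (R : realType) (n : nat) (Phi : 'rV[R]_n -> \bar R)
    (q u v : 'rV[R]_n) : \bar R :=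
  Phi u - Phi v - (inner q (u - v)%R)%:E.

(* The vector of partial derivatives; it is the Euclidean gradient at every
   point where f is differentiable. *)
Definition gradient (R : realType) (n : nat) (f : 'rV[R]_n -> R)
    (z : 'rV[R]_n) : 'rV[R]_n :=
  (\row_(i < n) 'D_(delta_mx 0 i) f z)%R.

Definition continuously_differentiable (R : realType) (n : nat)
    (f : 'rV[R]_n -> R) : Prop :=
  (forall z, differentiable f z) /\ continuous (gradient f).

(* G_x = grad_z B_Psi(x, .), for x in dom Psi. *)
Definition bregman_grad (R : realType) (n : nat) (Psi : 'rV[R]_n -> \bar R)
    (x z : 'rV[R]_n) : 'rV[R]_n :=
  gradient (fun z' => fine (bregman_loss Psi x z')) z.

(* Main.v *)
Require Import Defs.
From HB Require Import structures.
From mathcomp Require Import all_boot all_order all_algebra.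
From mathcomp Require Import boolp classical_sets reals ereal topology normedtype.
From mathcomp Require Import derive.
From mathcomp Require Import finmap functions landau ring lra.

(** The whole theorem rests on one fact: the proximal point [sigma z] exists, and
    [z - sigma z] is a subgradient of [Psi] at [sigma z].

    Existence is the direct method. A convex lower semicontinuous function
    decreases at most linearly in the distance to a point of its domain
    ([convex_norm_minorant]), so the quadratic term makes the energy coercive, and
    a lower semicontinuous function attains its minimum on a compact set
    ([lsc_compact_min], [prox_energy_min]). The subgradient property is the
    first-order condition along segments issuing from the minimiser
    ([minimizer_subgradient]).

    The subgradient inequality says that the supremum which defines the conjugate
    of [halfsq_plus Psi] at [z] is attained at [sigma z]. This gives the conjugate
    a finite closed form ([fconj_halfsq_plus]), whence the formulas for the loss
    by expansion of squares. They show that the loss dominates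
    [halfsq (x - sigma z)] and vanishes for [x = sigma z], which characterises its
    minimisers in [z].

    Two subgradient inequalities added together give firm non-expansiveness of
    [sigma] ([prox_cocoercive]), hence the three properties of the gradient map.
    For differentiability, [sigma z - x] is a subgradient of the loss in its
    second argument ([bregman_loss_subgradient]), so the error of the first-order
    expansion at [z] lies between 0 and [inner (sigma (z + k) - sigma z) k], which
    non-expansiveness bounds by the square of [k]
    ([subgradient_differentiable]). Convexity in [z] comes from the same
    subgradient inequality. *)

Set Implicit Arguments.
Unset Strict Implicit.
Unset Printing Implicit Defensive.

Import Order.TTheory GRing.Theory Num.Theory.
Import numFieldNormedType.Exports.

Local Open Scope classical_set_scope.
Local Open Scope ring_scope.
Local Open Scope ereal_scope.

(** * Euclidean structure *)
Section euclidean_structure.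
Context {R : realType} {n : nat}.
Implicit Types (x y z q k : 'rV[R]_n) (a t : R).
Local Open Scope ring_scope.

Lemma innerC x y : inner x y = inner y x.
Proof. by apply: eq_bigr => i _; rewrite mulrC. Qed.

Lemma inner_is_linear q : linear (inner q).
Proof.
move=> a x y; rewrite /inner [X in _ = X + _]mulr_sumr -big_split /=.
by apply: eq_bigr => i _; rewrite !mxE; ring.
Qed.

HB.instance Definition _ q :=
  GRing.isLinear.Build R 'rV[R]_n R _ (inner q) (inner_is_linear q).

Lemma innerDr x y z : inner x (y + z) = inner x y + inner x z.
Proof. exact: linearD. Qed.

Lemma innerNr x y : inner x (- y) = - inner x y.
Proof. exact: linearN. Qed.

Lemma innerZr x a y : inner x (a *: y) = a * inner x y.
Proof. exact: linearZ. Qed.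

Lemma innerDl x y z : inner (y + z) x = inner y x + inner z x.
Proof. by rewrite !(innerC _ x) innerDr. Qed.

Lemma innerNl x y : inner (- y) x = - inner y x.
Proof. by rewrite !(innerC _ x) innerNr. Qed.

Lemma innerZl x a y : inner (a *: y) x = a * inner y x.
Proof. by rewrite !(innerC _ x) innerZr. Qed.

Definition innerE := (innerDl, innerDr, innerNl, innerNr, innerZl, innerZr).

Lemma inner_delta x i : inner x (delta_mx 0 i) = x 0 i.
Proof.
rewrite /inner (bigD1 i) //= big1 ?mxE ?eqxx ?mulr1 ?addr0 // => j ji.
by rewrite mxE (negPf ji) andbF mulr0.
Qed.

Lemma inner_ge0 x : 0 <= inner x x.
Proof. by apply: sumr_ge0 => i _; rewrite -expr2 sqr_ge0. Qed.

Lemma inner_eq0 x : inner x x = 0 -> x = 0.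
Proof.
move=> /eqP; rewrite psumr_eq0 => [/allP x0|i _]; last by rewrite -expr2 sqr_ge0.
apply/rowP => i; rewrite mxE; apply/eqP.
by have := x0 i (mem_index_enum _); rewrite implyTb mulf_eq0 orbb.
Qed.

Lemma enorm_sqr x : enorm x ^+ 2 = inner x x.
Proof. by rewrite sqr_sqrtr ?inner_ge0. Qed.

Lemma halfsqE x : halfsq x = 2^-1 * inner x x.
Proof. by rewrite /halfsq enorm_sqr. Qed.

Lemma halfsq_ge0 x : 0 <= halfsq x.
Proof. by rewrite halfsqE mulr_ge0 ?inner_ge0 ?invr_ge0. Qed.

Lemma halfsq0 : halfsq (0 : 'rV[R]_n) = 0.
Proof. by rewrite halfsqE linear0 mulr0. Qed.

Lemma halfsq_eq0 x : halfsq x = 0 -> x = 0.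
Proof.
by rewrite halfsqE => /eqP; rewrite mulf_eq0 invr_eq0 pnatr_eq0 /= => /eqP/inner_eq0.
Qed.

Lemma coord_le_norm x i : `|x 0 i| <= `|x|.
Proof.
rewrite [leRHS]/Num.norm /= mx_normrE.
by apply/bigmax_geP; right => /=; exists (0, i).
Qed.

(** [`|x|] is the sup norm, which carries the topology: this bound and the next
    pass between it and the Euclidean norm, at the cost of the factor [n]. *)
Lemma norm_sqr_le_inner x : `|x| ^+ 2 <= inner x x.
Proof.
have [->|x0] := eqVneq `|x| 0; first by rewrite expr0n inner_ge0.
have [[u i] /= xi] : exists i : 'I_1 * 'I_n, `|x| = `|x i.1 i.2|.
  by apply: mx_norm_neq0.
rewrite xi (ord1 u) real_normK ?num_real // /inner (bigD1 i) //= expr2.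
by rewrite lerDl sumr_ge0 // => j _; rewrite -expr2 sqr_ge0.
Qed.

Lemma inner_le_norm_sqr x : inner x x <= n%:R * `|x| ^+ 2.
Proof.
rewrite /inner -[n in n%:R]card_ord mulr_natl -sumr_const ler_sum // => i _.
by rewrite -expr2 -[leLHS]real_normK ?num_real // lerXn2r ?nnegrE ?coord_le_norm.
Qed.

Lemma inner_continuous (T : topologicalType) (f g : T -> 'rV[R]_n) :
  continuous f -> continuous g -> continuous (fun t : T => inner (f t) (g t)).
Proof.
move=> cf cg; apply: continuous_big => [|i _ t]; first exact: add_continuous.
apply: continuousM.
  by apply: (@continuous_comp _ _ _ f (fun x : 'rV[R]_n => x 0 i) t);
    [exact: cf | exact: coord_continuous].
by apply: (@continuous_comp _ _ _ g (fun x : 'rV[R]_n => x 0 i) t);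
    [exact: cg | exact: coord_continuous].
Qed.

Lemma halfsq_dist_continuous z : continuous (fun x : 'rV[R]_n => halfsq (x - z)).
Proof.
have -> : (fun x => halfsq (x - z)) = (fun x => 2^-1 * inner (x - z) (x - z)).
  by apply/funext => x; rewrite halfsqE.
have csub : continuous (fun x : 'rV[R]_n => x - z).
  by move=> x; apply: continuousB; [by [] | exact: cst_continuous].
move=> x; apply: (@continuousM _ _ (fun=> 2^-1) (fun y => inner (y - z) (y - z))).
  exact: cst_continuous.
exact: (inner_continuous csub csub).
Qed.

(** Expand [0 <= inner (b - a) (b - a)]. With [a] the difference of two values of
    a map and [b] that of the arguments, firm non-expansiveness thus implies
    non-expansiveness. *)
Lemma cocoercive_le (a b : 'rV[R]_n) :
  (inner a a <= inner a b -> inner a b <= inner b b)%R.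
Proof.
by have := inner_ge0 (b - a); rewrite !innerE (innerC b a); lra.
Qed.

Lemma compact_sup_ball (x0 : 'rV[R]_n) (M : R) :
  compact [set x : 'rV[R]_n | (`|x - x0| <= M)%R].
Proof.
apply: bounded_closed_compact.
  exists (`|x0| + M)%R; split; first exact: num_real.
  move=> r /ltW Mr x /= xM; apply: le_trans Mr.
  by rewrite -[x in leLHS](subrK x0) addrC (le_trans (ler_normD _ _)) // lerD2l.
rewrite (_ : mkset _ = (fun x : 'rV[R]_n => `|x - x0|%R) @^-1` [set r | (r <= M)%R]) //.
apply: closed_comp; last exact: closed_le.
move=> x _; apply: continuous_comp; last exact: norm_continuous.
by apply: continuousB; [by [] | exact: cst_continuous].
Qed.

End euclidean_structure.

(** * Lower semicontinuous functions *)
Section lower_semicontinuity.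

(** If there were no minimiser, the open sets where [f] exceeds [f y], for [y] in
    [K], would cover [K]; the [y] of least value in a finite subcover lies in
    none of its sets. *)
Lemma lsc_compact_min (R : realType) (T : ptopologicalType) (f : T -> \bar R)
    (K : set T) :
  lower_semicontinuous f -> compact K -> K !=set0 ->
  exists2 y, K y & forall x, K x -> f y <= f x.
Proof.
move=> /lower_semicontinuousP flsc cK [x0 Kx0]; apply: contrapT => nomin.
have below x : K x -> exists2 y, K y & f y < f x.
  move=> Kx; apply: contrapT => nobelow; apply: nomin; exists x => // y Ky.
  by rewrite leNgt; apply/negP => yx; apply: nobelow; exists y.
have fNy y : K y -> f y != -oo.
  by move=> /below[x _]; case: (f y) => //; rewrite ltNge leNye.
have fopen y : K y -> open [set x | f y < f x].
  move=> Ky; have := fNy _ Ky; case fy : (f y) => [r| |] // _.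
  (* Only [f y = +oo] is left: a real value is covered by [flsc]. *)
  rewrite (_ : mkset _ = set0); first exact: open0.
  by rewrite -subset0 => x /=; rewrite ltNge leey.
have Kcover : K `<=` cover K (fun y => [set x | f y < f x]).
  by move=> x /below[y Ky yx]; exists y.
move: cK; rewrite compact_cover => /(_ _ _ _ fopen Kcover)[D DK Dcover].
have [d0 /= Dd0 _] := Dcover _ Kx0.
have [d _ dmin] := @arg_minP _ _ _ [` Dd0]%fset xpredT (fun d => f (fsval d)) erefl.
have /set_mem Kd := DK _ (fsvalP d).
have [e /= De] := Dcover _ Kd.
by rewrite ltNge (dmin [` De]%fset).
Qed.

(** A level below [g x + f x] splits into a level [a - b] below [g x] and a level
    [b] below [f x], and each of them persists near [x]. *)
Lemma lsc_addl (R : realType) (T : topologicalType) (g : T -> R)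
    (f : T -> \bar R) :
  continuous g -> lower_semicontinuous f ->
  lower_semicontinuous (fun x => (g x)%:E + f x).
Proof.
move=> cg flsc x a axf.
have [b abg bf] : exists2 b, (a - b < g x)%R & b%:E < f x.
  move: axf; case: (f x) => [r| |] //=; last first.
    by move=> _; exists (a - g x + 1)%R; rewrite ?ltry //; lra.
  rewrite -EFinD lte_fin => ?; exists ((r + (a - g x)) / 2)%R; first lra.
  by rewrite lte_fin; lra.
have [V xV Vf] := flsc _ _ bf.
exists (V `&` [set y | (a - b < g y)%R]).
  by apply: filterI => //; exact: (cvgr_gt (g x)) (cg x) _ abg.
move=> y [/Vf byf /= abgy]; apply: le_lt_trans (_ : (a - b)%:E + b%:E < _).
  by rewrite -EFinD subrK.
by apply: lteD; rewrite ?lte_fin.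
Qed.

End lower_semicontinuity.

(** * Convexity and differentiability from subgradients *)
Section subgradients.
Context {R : realType} {n : nat}.

(** It is enough to test convexity on finite values and interior weights: the
    convention [0 * +oo = 0] makes the weights 0 and 1 trivial, and an infinite
    value with a positive weight makes the right-hand side infinite. *)
Lemma econvex_fin (F : 'rV[R]_n -> \bar R) : (forall x, -oo < F x) ->
  (forall x y (a b t : R), F x = a%:E -> F y = b%:E -> (0 < t < 1)%R ->
    F (t *: x + (1 - t) *: y)%R <= (t * a + (1 - t) * b)%:E) ->
  econvex F.
Proof.
move=> Ny Fconvex x y t /andP[].
rewrite le_eqVlt => /predU1P[<- _|t0].
  by rewrite scale0r add0r subr0 scale1r mul0e add0e mul1e.
rewrite le_eqVlt => /predU1P[->|t1].
  by rewrite subrr scale1r scale0r addr0 mul0e mul1e adde0.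
have s0 : (0 < 1 - t)%R by rewrite subr_gt0.
have := Ny x; have := Ny y.
case xa : (F x) => [a| |] //; case yb : (F y) => [b| |] // _ _.
- by rewrite -!EFinM -EFinD Fconvex // t0 t1.
- by rewrite gt0_muley // addey // leey.
- by rewrite gt0_muley // addye // leey.
- by rewrite !gt0_muley // leey.
Qed.

Local Open Scope ring_scope.

(** The subgradient inequalities at [z] and at [z + k] enclose the error
    [f (z + k) - f z - inner (g z) k] between 0 and
    [inner (g (z + k) - g z) k], which the second hypothesis makes quadratic in
    [k]. So a one-sided Lipschitz selection of subgradients is the gradient. *)
Lemma subgradient_differentiable (f : 'rV[R]_n -> R) (g : 'rV[R]_n -> 'rV[R]_n) :
  (forall z z', f z + inner (g z) (z' - z) <= f z') ->
  (forall z z', inner (g z - g z') (z - z') <= inner (z - z') (z - z')) ->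
  forall z, differentiable f z /\ gradient f z = g z.
Proof.
move=> fg glip z.
have cg : continuous (inner (g z)).
  by apply: (@inner_continuous _ _ _ (fun=> g z) id) => x;
    [exact: cst_continuous | by []].
have fz : f \o shift z = cst (f z) + inner (g z) +o_ (0 : 'rV[R]_n) id.
  apply/eqaddoP => e e0.
  have near0 : \forall k \near (0 : 'rV[R]_n), `|k| <= e / n.+1%:R.
    by apply: nbhs0_le; rewrite divr_gt0 ?ltr0n.
  apply: filterS near0 => k ksmall.
  rewrite (_ : (_ - _) k = f (k + z) - (f z + inner (g z) k)) //.
  have lo := fg z (k + z); have hi := fg (k + z) z; have gk := glip (k + z) z.
  rewrite addrK in lo gk.
  have hi' : f (k + z) - (f z + inner (g z) k) <= inner k k.
    move: hi gk; rewrite (_ : z - (k + z) = - k); last by rewrite opprD addrC subrK.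
    by rewrite !innerE; lra.
  rewrite ger0_norm ?subr_ge0 //.
  (* The bound [n * `|k| ^+ 2] is at most [e * `|k|] once
     [`|k| <= e / n.+1]; the successor avoids a division by 0 in dimension 0. *)
  apply: (le_trans hi'); apply: (le_trans (inner_le_norm_sqr k)).
  rewrite expr2 mulrA ler_wpM2r //.
  apply: (@le_trans _ _ (n.+1%:R * (e / n.+1%:R))).
    by apply: ler_pM => //; rewrite ler_nat.
  by rewrite mulrC divfK // pnatr_eq0.
have dfz := diff_unique cg fz.
have df : differentiable f z.
  by apply/diff_locallyP; rewrite dfz; split.
split=> //; apply/rowP => i; rewrite mxE deriveE // dfz.
exact: inner_delta.
Qed.

Lemma nonexpansive_continuous (g : 'rV[R]_n -> 'rV[R]_n) :
  (forall z z', inner (g z - g z') (g z - g z') <= inner (z - z') (z - z')) ->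
  continuous g.
Proof.
move=> gne z; apply/(@cvgrPdist_le _ _ _ _ (nbhs_filter z)) => e e0.
have : \forall y \near z, `|z - y| <= e / n.+1%:R.
  by apply: (@cvgr_dist_le _ _ _ _ (nbhs_filter z) id);
    [exact: cvg_id | rewrite divr_gt0 ?ltr0n].
apply: filterS => y ysmall.
rewrite -(@ler_pXn2r _ 2) ?nnegrE ?(ltW e0) //.
apply: (le_trans (norm_sqr_le_inner _)); apply: (le_trans (gne _ _)).
apply: (le_trans (inner_le_norm_sqr _)).
apply: (@le_trans _ _ (n%:R * (e / n.+1%:R) ^+ 2)).
  by rewrite ler_wpM2l // ler_pXn2r ?nnegrE // divr_ge0 // (ltW e0).
rewrite expr_div_n mulrCA ger_pMr ?exprn_gt0 // ler_pdivrMr ?exprn_gt0 ?ltr0n //.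
by rewrite mul1r -natrX ler_nat (leq_trans (leqnSn n)) // expnS leq_pmulr.
Qed.

End subgradients.

(** * Existence and first-order condition for the proximal point *)
Section prox_existence.
Context {R : realType} {n : nat} (Psi : 'rV[R]_n -> \bar R).
Context (Psi_proper : eproper Psi) (Psi_lsc : lower_semicontinuous Psi)
  (Psi_convex : econvex Psi).
Implicit Types x z s u : 'rV[R]_n.

Lemma proper_finite : exists x0 (r0 : R), Psi x0 = r0%:E.
Proof.
have [Ny [x0]] := Psi_proper; have := Ny x0.
by case x0E : (Psi x0) => [r0| |] //; exists x0, r0.
Qed.

(** Let [m] be the minimum of [Psi] on the compact unit ball around [x0]. The
    segment from [x0] to [x] leaves this ball at a point where [Psi] is at least
    [m]; convexity along the segment then bounds [Psi x] below, with
    [d = r0 - m]. *)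
Lemma convex_norm_minorant x0 (r0 : R) : Psi x0 = r0%:E ->
  exists2 d : R, (0 <= d)%R &
    forall x, (1 <= `|x - x0|)%R -> (r0 - `|x - x0| * d)%:E <= Psi x.
Proof.
move=> x0E.
have x0ball : (`|x0 - x0| <= 1)%R by rewrite subrr normr0.
have [y _ ymin] := lsc_compact_min Psi_lsc (compact_sup_ball (M := 1))
  (ex_intro _ x0 x0ball).
have x0y : Psi y <= r0%:E by rewrite -x0E; exact: ymin.
have [Ny _] := Psi_proper.
have [m ym] : exists m : R, Psi y = m%:E.
  by move: x0y (Ny y); case: (Psi y) => // m; exists m.
rewrite ym lee_fin in x0y.
exists (r0 - m)%R; first by rewrite subr_ge0.
move=> x x1; set r := `|x - x0|%R in x1 *.
have r0' : (0 < r)%R by apply: lt_le_trans x1.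
have t01 : (0 <= r^-1 <= 1)%R by rewrite invr_ge0 ltW //= invf_le1.
have := Psi_convex x x0 t01; rewrite x0E.
have := ymin (r^-1 *: x + (1 - r^-1) *: x0)%R.
rewrite ym => /(_ _)/le_trans le1 /le1{le1}.
have ball : (`|r^-1 *: x + (1 - r^-1) *: x0 - x0| <= 1)%R.
  rewrite (_ : _ - _ = r^-1 *: (x - x0))%R; last first.
    by rewrite scalerBl scale1r scalerBr addrCA addrAC subrr add0r addrC.
  by rewrite normrZ gtr0_norm ?invr_gt0 // -/r mulVf // gt_eqF.
move=> /(_ ball); have := Ny x; case: (Psi x) => [s| |] // _; last by rewrite leey.
rewrite -!EFinM -EFinD !lee_fin -(ler_pM2l r0') => le2.
have rV : (r * r^-1 = 1)%R by rewrite divff // gt_eqF.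
have -> : (s = r * (r^-1 * s + (1 - r^-1) * r0) - (r - 1) * r0)%R.
  rewrite mulrDr mulrA rV mulrA mulrBr rV; ring.
by lra.
Qed.

(** The quadratic term dominates the linear decrease allowed by
    [convex_norm_minorant], so outside a large enough ball the energy exceeds its
    value at [x0], and a minimiser over that ball is a global one. *)
Lemma prox_energy_min z : argmin (prox_energy Psi z) !=set0.
Proof.
have [x0 [r0 x0E]] := proper_finite.
have [d d0 dP] := convex_norm_minorant x0E.
have Elsc : lower_semicontinuous (prox_energy Psi z).
  by apply: lsc_addl => //; exact: halfsq_dist_continuous.
pose c := `|x0 - z|%R; pose e := halfsq (x0 - z).
(* [M] is chosen so that [(r - c) ^+ 2 / 2 >= r * d + e] for all [r >= M], where
   [r] stands for the distance to [x0]. *)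
pose M := (c + (2 * d + 1 + 2 * c * d + 2 * e))%R.
have c0 : (0 <= c)%R by exact: normr_ge0.
have e0 : (0 <= e)%R by exact: halfsq_ge0.
have cd0 : (0 <= c * d)%R by rewrite mulr_ge0.
have M0 : (1 <= M)%R by rewrite /M; lra.
have x0ball : (`|x0 - x0| <= M)%R by rewrite subrr normr0 (le_trans _ M0).
have [s _ smin] := lsc_compact_min Elsc (compact_sup_ball (M := M))
  (ex_intro _ x0 x0ball).
have sx0 : prox_energy Psi z s <= prox_energy Psi z x0 by exact: smin.
exists s => v; have [/smin //|vM] := leP `|v - x0|%R M.
apply: (le_trans sx0); rewrite /prox_energy x0E -EFinD.
apply: le_trans (_ : (halfsq (v - z))%:E + (r0 - `|v - x0| * d)%:E <= _); last first.
  by rewrite leeD2l // dP // (le_trans M0) ?ltW.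
rewrite -EFinD lee_fin -/e halfsqE.
set r := `|v - x0|%R in vM *.
have vz : (r - c <= `|v - z|)%R.
  rewrite lerBlDr /r (_ : v - x0 = (v - z) - (x0 - z))%R.
    exact: ler_normB.
  by rewrite opprB addrA subrK.
have vz2 := norm_sqr_le_inner (v - z).
pose w := (r - c - (2 * d + 1 + 2 * c * d + 2 * e))%R.
have w0 : (0 < w)%R by rewrite /w; move: vM; rewrite /M; lra.
have sq : ((r - c) ^+ 2 <= `|v - z| ^+ 2)%R.
  by rewrite ler_pXn2r ?nnegrE //; move: vM; rewrite /M; lra.
have : (0 <= 2^-1 * (r - c) ^+ 2 - r * d - e)%R.
  rewrite (_ : r = w + c + (2 * d + 1 + 2 * c * d + 2 * e))%R; last by rewrite /w; ring.
  by nra.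
lra.
Qed.

(** Compare the energy at [s] with its value at the point [t] of the way from [s]
    to [u]: convexity of [Psi] gives the subgradient inequality up to the error
    [t * halfsq (u - s)], which vanishes as [t] tends to 0. *)
Lemma minimizer_subgradient z s :
  argmin (prox_energy Psi z) s -> subdiff Psi s (z - s)%R.
Proof.
move=> smin; have [Ny _] := Psi_proper.
have [x0 [r0 x0E]] := proper_finite.
have [p sp] : exists p : R, Psi s = p%:E.
  have := smin x0; rewrite /prox_energy x0E -EFinD; have := Ny s.
  by case: (Psi s) => // p; exists p.
split=> [|u]; first by rewrite sp ltry.
have := Ny u; rewrite sp; case ur : (Psi u) => [r| |] // _; last by rewrite leey.
rewrite -EFinD lee_fin.
have step (t : R) : (0 < t <= 1)%R ->
    (p + inner (z - s) (u - s) <= r + t * halfsq (u - s))%R.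
  move=> /andP[t0 t1].
  have := smin (t *: u + (1 - t) *: s)%R.
  have := Psi_convex u s (_ : 0 <= t <= 1)%R; rewrite ur sp t1 ltW // => /(_ isT).
  rewrite /prox_energy sp -!EFinM -!EFinD => /(leeD2l _) le1 /le_trans /(_ (le1 _)).
  rewrite -EFinD lee_fin !halfsqE !innerE.
  rewrite (innerC s z) (innerC u z) (innerC s u) => le2.
  rewrite -(ler_pM2l t0); nra.
rewrite leNgt; apply/negP => lt1.
pose a := (p + inner (z - s) (u - s) - r)%R.
have a0 : (0 < a)%R by rewrite /a; lra.
have c0 := halfsq_ge0 (u - s); set c := halfsq (u - s) in step c0.
have ac0 : (0 < a + c + 1)%R by lra.
(* A violation by [a > 0] is refuted by this [t], for which [t * c < a]. *)
have t01 : (0 < a / (a + c + 1) <= 1)%R.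
  by rewrite divr_gt0 //= ler_pdivrMr //; lra.
have := step _ t01.
have : (a / (a + c + 1) * c < a)%R.
  by rewrite mulrAC ltr_pdivrMr // ltr_pM2l //; lra.
by rewrite /a; lra.
Qed.

End prox_existence.

(** * The Bregman loss *)
Section bregman_loss.
Context {R : realType} {n : nat} (Psi : 'rV[R]_n -> \bar R).
Context (Psi_proper : eproper Psi) (Psi_lsc : lower_semicontinuous Psi)
  (Psi_convex : econvex Psi).
Implicit Types x y z : 'rV[R]_n.

Local Notation sigma := (prox Psi).
Local Notation B := (bregman_loss Psi).
Local Notation psi := (fun z => fine (Psi (sigma z))).

Lemma prox_subgradient z : subdiff Psi (sigma z) (z - sigma z)%R.
Proof.
apply: minimizer_subgradient => //.
by have [s smin] := prox_energy_min Psi_proper Psi_lsc Psi_convex z; exact: xgetI smin.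
Qed.

Lemma prox_fin z : Psi (sigma z) = (psi z)%:E.
Proof.
have [Ny _] := Psi_proper; have [fin _] := prox_subgradient z.
by rewrite fineK // fin_numElt Ny fin.
Qed.

Lemma prox_subgradient_fin x (r : R) z : Psi x = r%:E ->
  (psi z + inner (z - sigma z) (x - sigma z) <= r)%R.
Proof.
move=> xr; have [_ /(_ x)] := prox_subgradient z.
by rewrite xr prox_fin -EFinD lee_fin.
Qed.

(** Firm non-expansiveness of the proximal map: add the subgradient inequality at
    [sigma z], tested at [sigma z'], to the one with the roles exchanged. *)
Lemma prox_cocoercive z z' :
  (inner (sigma z - sigma z') (sigma z - sigma z')
    <= inner (sigma z - sigma z') (z - z'))%R.
Proof.
have := prox_subgradient_fin z (prox_fin z').
have := prox_subgradient_fin z' (prox_fin z).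
move: (sigma z) (sigma z') => s s'.
rewrite !innerE (innerC z s) (innerC z s') (innerC z' s) (innerC z' s') (innerC s' s).
lra.
Qed.

(** Monotonicity of the subdifferential: [q] at [x] and [x + q - sigma (x + q)] at
    [sigma (x + q)] are two subgradients whose difference is the opposite of the
    difference of their base points. *)
Lemma prox_add_subgradient x q : subdiff Psi x q -> sigma (x + q)%R = x.
Proof.
move=> [xfin xsub]; have [Ny _] := Psi_proper.
have xr : Psi x = (fine (Psi x))%:E by rewrite fineK // fin_numElt Ny xfin.
have := prox_subgradient_fin (x + q)%R xr; have := xsub (sigma (x + q)%R).
rewrite prox_fin xr -EFinD lee_fin => le1 le2.
apply/eqP; rewrite -subr_eq0; apply/eqP/inner_eq0/eqP.
rewrite eq_le inner_ge0 andbT; move: le1 le2; move: (sigma _) => s.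
rewrite !innerE (innerC x s); lra.
Qed.

(** The supremum is attained at [sigma z] because [inner x z - halfsq x - Psi x]
    differs from minus the energy of [x] by [halfsq z]. The finite value makes
    every subtraction in the Bregman loss meaningful. *)
Lemma fconj_halfsq_plus z :
  fconj (halfsq_plus Psi) z
    = (inner (sigma z) z - halfsq (sigma z) - psi z)%:E.
Proof.
have [Ny _] := Psi_proper.
apply/eqP; rewrite eq_le; apply/andP; split; last first.
  apply: ereal_sup_ubound; exists (sigma z) => //.
  rewrite /halfsq_plus prox_fin -EFinD; congr EFin => /=; ring.
apply: ge_ereal_sup => _ [x _ <-]; rewrite /halfsq_plus.
have := Ny x; case xr : (Psi x) => [r| |] // _; last exact: leNye.
rewrite -EFinD lee_fin.
have := prox_subgradient_fin z xr; have := inner_ge0 (x - sigma z).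
move: (sigma z) => s; rewrite !halfsqE !innerE (innerC z s) (innerC z x) (innerC x s).
lra.
Qed.

(** From here on the conjugate is gone, and the other expressions for the loss
    follow from this one by algebra over [Psi x], finite or infinite. *)
Lemma bregman_lossE x z : B x z =
  (halfsq (x - sigma z))%:E + Psi x - Psi (sigma z)
    - (inner (z - sigma z)%R (x - sigma z)%R)%:E.
Proof.
have [Ny _] := Psi_proper.
rewrite /bregman_loss fconj_halfsq_plus prox_fin.
have := Ny x; case xr : (Psi x) => [r| |] // _.
rewrite -?EFinN -?EFinD; congr EFin.
move: (sigma z) => s; rewrite !halfsqE !innerE (innerC z s) (innerC z x) (innerC x s).
by field.
Qed.

Lemma bregman_loss_energy x z :
  B x z = prox_energy Psi z x - prox_energy Psi z (sigma z).
Proof.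
have [Ny _] := Psi_proper.
rewrite bregman_lossE /prox_energy prox_fin.
have := Ny x; case xr : (Psi x) => [r| |] // _.
rewrite -?EFinN -?EFinD -?EFinN -?EFinD; congr EFin.
move: (sigma z) => s; rewrite !halfsqE !innerE (innerC z s) (innerC z x) (innerC x s).
by field.
Qed.

Lemma bregman_loss_dist_halfsq_plus x z :
  B x z = bregman_dist (halfsq_plus Psi) z x (sigma z).
Proof.
have [Ny _] := Psi_proper.
rewrite bregman_lossE /bregman_dist /halfsq_plus prox_fin.
have := Ny x; case xr : (Psi x) => [r| |] // _.
rewrite -?EFinN -?EFinD -?EFinN -?EFinD; congr EFin.
move: (sigma z) => s; rewrite !halfsqE !innerE (innerC z s) (innerC z x) (innerC x s).
by field.
Qed.

Lemma bregman_loss_dist x z :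
  B x z = (halfsq (x - sigma z))%:E
          + bregman_dist Psi (z - sigma z)%R x (sigma z).
Proof.
have [Ny _] := Psi_proper.
rewrite bregman_lossE /bregman_dist prox_fin.
have := Ny x; case xr : (Psi x) => [r| |] // _.
by rewrite -?EFinN -?EFinD; congr EFin; ring.
Qed.

Lemma prox_subgradient_halfsq_plus z : subdiff (halfsq_plus Psi) (sigma z) z.
Proof.
have [Ny _] := Psi_proper.
rewrite /subdiff /halfsq_plus /= prox_fin -EFinD; split=> [|x]; first by rewrite ltry.
have := Ny x; case xr : (Psi x) => [r| |] // _; last by rewrite addey // leey.
rewrite -!EFinD lee_fin.
have := prox_subgradient_fin z xr; have := inner_ge0 (x - sigma z).
move: (sigma z) => s; rewrite !halfsqE !innerE (innerC z s) (innerC z x) (innerC x s).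
lra.
Qed.

Lemma bregman_dist_prox_ge0 x z : 0 <= bregman_dist Psi (z - sigma z)%R x (sigma z).
Proof.
have [Ny _] := Psi_proper.
rewrite /bregman_dist prox_fin.
have := Ny x; case xr : (Psi x) => [r| |] // _; last exact: leey.
rewrite -?EFinN -?EFinD lee_fin; have := prox_subgradient_fin z xr; lra.
Qed.

Lemma bregman_loss_ge x z : (halfsq (x - sigma z))%:E <= B x z.
Proof. by rewrite bregman_loss_dist leeDl // bregman_dist_prox_ge0. Qed.

Lemma bregman_loss_fin x z : edom Psi x -> B x z \is a fin_num.
Proof.
have [Ny _] := Psi_proper; rewrite bregman_lossE prox_fin => xdom.
have := Ny x; move: xdom; rewrite /edom /=; case: (Psi x) => [r| |] //.
Qed.

(** Apart from terms affine in the second argument, the loss is the conjugate, a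
    supremum of affine functions attained at [sigma z]; that affine function
    supports it at [z]. *)
Lemma bregman_loss_subgradient x z z' : edom Psi x ->
  (fine (B x z) + inner (sigma z - x) (z' - z) <= fine (B x z'))%R.
Proof.
have [Ny _] := Psi_proper; rewrite !bregman_lossE (prox_fin z) (prox_fin z') => xdom.
have := Ny x; move: xdom; rewrite /edom /=; case: (Psi x) => [r| |] // _ _.
rewrite -?EFinN -?EFinD /=.
have := prox_subgradient_fin z' (prox_fin z).
have := inner_ge0 (sigma z - sigma z').
move: (sigma z) (sigma z') => s s'.
rewrite !halfsqE !innerE (innerC z s) (innerC z' s) (innerC z' s') (innerC x s).
rewrite (innerC x s') (innerC z x) (innerC z' x) (innerC s' s).
lra.
Qed.

Lemma bregman_grad_cocoercive (x z z' : 'rV[R]_n) :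
  let G z := (sigma z - x)%R in
  (inner (G z - G z') (G z - G z') <= inner (G z - G z') (z - z'))%R.
Proof.
rewrite /= (_ : (_ - _ - _ = sigma z - sigma z')%R); first exact: prox_cocoercive.
by rewrite opprB addrA subrK.
Qed.

Lemma bregman_loss_differentiable x z : edom Psi x ->
  differentiable (fun z => fine (B x z)) z /\
  gradient (fun z => fine (B x z)) z = (sigma z - x)%R.
Proof.
move=> xdom; apply: (@subgradient_differentiable _ _ _ (fun z => sigma z - x)%R).
  by move=> *; exact: bregman_loss_subgradient.
by move=> y y'; apply/cocoercive_le/bregman_grad_cocoercive.
Qed.

Lemma bregman_gradE x z : edom Psi x -> bregman_grad Psi x z = (sigma z - x)%R.
Proof. by move=> /(bregman_loss_differentiable z)[]. Qed.

Lemma bregman_loss_C1 x : edom Psi x ->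
  continuously_differentiable (fun z => fine (B x z)).
Proof.
move=> xdom; split=> [z|]; first by have [] := bregman_loss_differentiable z xdom.
rewrite (_ : gradient _ = (fun z => sigma z - x)%R); last first.
  by apply/funext => z; have [] := bregman_loss_differentiable z xdom.
apply: nonexpansive_continuous => z z'.
have coco := bregman_grad_cocoercive x z z'.
exact: le_trans coco (cocoercive_le coco).
Qed.

Lemma bregman_loss_prox z : B (sigma z) z = 0.
Proof.
by rewrite bregman_lossE prox_fin !subrr linear0 halfsq0 add0e sube0 -EFinB subrr.
Qed.

(** The loss dominates [halfsq (x - sigma z)], so it is nonnegative and vanishes
    only when [x = sigma z]. A subgradient [q] at [x] ensures that 0 is attained,
    namely at [x + q]. *)
Lemma argmin_bregman_loss x z :
  subdiff Psi x !=set0 -> argmin (B x) z <-> x = sigma z.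
Proof.
move=> [q qsub]; split=> [zmin|-> y]; last first.
  rewrite bregman_loss_prox (le_trans _ (bregman_loss_ge _ _)) //.
  by rewrite lee_fin halfsq_ge0.
have xE : sigma (x + q)%R = x by exact: prox_add_subgradient.
have := zmin (x + q)%R; rewrite -{2}xE bregman_loss_prox.
move=> /(le_trans (bregman_loss_ge _ _)); rewrite lee_fin => le0.
apply/eqP; rewrite -subr_eq0; apply/eqP/halfsq_eq0/eqP.
by rewrite eq_le le0 halfsq_ge0.
Qed.

Lemma argmin_bregman_loss_neq0 x : subdiff Psi x !=set0 -> argmin (B x) !=set0.
Proof.
move=> xsub; have [q qsub] := xsub; exists (x + q)%R.
by apply/argmin_bregman_loss => //; rewrite prox_add_subgradient.
Qed.

Lemma bregman_loss_gtNy x z : -oo < B x z.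
Proof. by rewrite (lt_le_trans _ (bregman_loss_ge x z)) // ltNyr. Qed.

(** In its first argument the loss is [halfsq] plus [Psi] plus an affine function,
    and the convexity gap of [halfsq] is [t * (1 - t) * halfsq (x - y)]. *)
Lemma bregman_loss_convexl z : econvex (fun x => B x z).
Proof.
have [Ny _] := Psi_proper.
apply: econvex_fin => [x|x y a b t]; first exact: bregman_loss_gtNy.
rewrite !bregman_lossE prox_fin.
have := Ny x; have := Ny y.
case xr : (Psi x) => [r| |] //; case yr' : (Psi y) => [r'| |] // _ _.
rewrite -?EFinN -?EFinD => -[<-] [<-] /andP[t0 t1].
have t01 : (0 <= t <= 1)%R by rewrite !ltW.
have := Psi_convex x y t01; rewrite xr yr'.
have := Ny (t *: x + (1 - t) *: y)%R; case: (Psi _) => [w| |] // _.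
rewrite -!EFinM -?EFinN -!EFinD !lee_fin => le1.
have s0 : (0 <= 1 - t)%R by rewrite subr_ge0 ltW.
have := mulr_ge0 (mulr_ge0 (ltW t0) s0) (inner_ge0 (x - y)).
move: le1; move: (sigma z) => s; rewrite !halfsqE !innerE.
rewrite (innerC z s) (innerC z x) (innerC z y) (innerC x s) (innerC y s) (innerC y x).
lra.
Qed.

(** The subgradient inequality at the intermediate point, applied to both ends and
    averaged, cancels the linear term. *)
Lemma bregman_loss_convexr x : econvex (B x).
Proof.
apply: econvex_fin => [z|y z a b t ya zb]; first exact: bregman_loss_gtNy.
have [Ny _] := Psi_proper => /andP[t0 t1].
have xdom : edom Psi x.
  move: ya; rewrite bregman_lossE prox_fin /edom /=.
  by case: (Psi x) (Ny x) => [r| |] //; rewrite ltry.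
rewrite -(fineK (bregman_loss_fin _ xdom)) lee_fin.
have := bregman_loss_subgradient (t *: y + (1 - t) *: z)%R y xdom.
have := bregman_loss_subgradient (t *: y + (1 - t) *: z)%R z xdom.
rewrite ya zb /=; set w := (sigma _ - x)%R; set f := fine _.
rewrite !innerE; nra.
Qed.

End bregman_loss.

Theorem theorem10 (R : realType) (n : nat) (Psi : 'rV[R]_n -> \bar R)
    (Psi_proper : eproper Psi) (Psi_lsc : lower_semicontinuous Psi)
    (Psi_convex : econvex Psi) :
  let sigma := prox Psi in
  let B := bregman_loss Psi in
  let E := prox_energy Psi in
  let G := bregman_grad Psi in
  (* 1 *)
  (forall x z, B x z = E z x - E z (sigma z)) /\
  (* 2 *)
  (forall x z,
     subdiff (halfsq_plus Psi) (sigma z) z /\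
     B x z = bregman_dist (halfsq_plus Psi) z x (sigma z)) /\
  (* 3 *)
  (forall x z,
     [/\ subdiff Psi (sigma z) (z - sigma z)%R,
         B x z = (halfsq (x - sigma z))%:E
                 + bregman_dist Psi (z - sigma z)%R x (sigma z)
       & (halfsq (x - sigma z))%:E <=
         (halfsq (x - sigma z))%:E
                 + bregman_dist Psi (z - sigma z)%R x (sigma z)]) /\
  (* 4 *)
  (forall x z,
     B x z = (halfsq (x - sigma z))%:E + Psi x - Psi (sigma z)
             - (inner (z - sigma z)%R (x - sigma z)%R)%:E) /\
  (* 5 *)
  (forall x, edom Psi x ->
     (forall z, B x z \is a fin_num) /\
     continuously_differentiable (fun z => fine (B x z))) /\
  (* 6 *)
  (forall x z, edom Psi x -> G x z = (sigma z - x)%R) /\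
  (* 7 *)
  (forall x, subdiff Psi x !=set0 ->
     argmin (B x) !=set0 /\ (forall z, argmin (B x) z <-> x = sigma z)) /\
  (* 8 *)
  ((forall z, econvex (fun x => B x z)) /\ (forall x, econvex (B x))) /\
  (* 9 *)
  (forall x z1 z2, edom Psi x ->
     (0 <= inner (G x z1 - G x z2) (z1 - z2))%R) /\
  (* 10 *)
  (forall x z1 z2, edom Psi x ->
     (enorm (G x z1 - G x z2) <= enorm (z1 - z2))%R) /\
  (* 11 *)
  (forall x z1 z2, edom Psi x ->
     (enorm (G x z1 - G x z2) ^+ 2 <= inner (G x z1 - G x z2) (z1 - z2))%R).
Proof.
have GE := bregman_gradE Psi_proper Psi_lsc Psi_convex.
have coco := bregman_grad_cocoercive Psi_proper Psi_lsc Psi_convex.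
move=> sigma B E G; split; [|split; [|split; [|split; [|split; [|split;
  [|split; [|split; [|split; [|split]]]]]]]]].
- by move=> x z; exact: bregman_loss_energy.
- move=> x z; split; first exact: prox_subgradient_halfsq_plus.
  exact: bregman_loss_dist_halfsq_plus.
- move=> x z; split; [exact: prox_subgradient | exact: bregman_loss_dist |].
  by rewrite leeDl // bregman_dist_prox_ge0.
- by move=> x z; exact: bregman_lossE.
- move=> x xdom; split=> [z|]; first exact: bregman_loss_fin.
  exact: bregman_loss_C1.
- by move=> x z; exact: GE.
- move=> x xsub; split=> [|z]; first exact: argmin_bregman_loss_neq0.
  exact: argmin_bregman_loss.
- split; first exact: bregman_loss_convexl.
  exact: bregman_loss_convexr.
- move=> x z1 z2 xdom; rewrite /G !GE //.
  exact: le_trans (inner_ge0 _) (coco x z1 z2).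
- move=> x z1 z2 xdom; rewrite /G !GE // /enorm ler_sqrt ?inner_ge0 //.
  exact: le_trans (coco x z1 z2) (cocoercive_le (coco x z1 z2)).
- by move=> x z1 z2 xdom; rewrite /G !GE // enorm_sqr; exact: coco.
Qed.
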